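(* Let $K$ be a field of characteristic zero, let $A:=A_n\otimes P_m$ be the $n$'th Weyl algebra with polynomial coefficients over $K$, let $s:=2n+m$, let $\partial_1,\ldots,\partial_s\in\mathrm{Der}_K(A)$ be the formal partial derivatives, and let $\widehat A:=A[[\partial_1,\ldots,\partial_s]]$ be the algebra of formal series in $\partial_1,\ldots,\partial_s$ with coefficients in $A$. Then $\widehat A=\mathrm{End}_K(A)$; that is, the natural algebra homomorphism $\widehat A\to\mathrm{End}_K(A)$ is an isomorphism.
   Context: The Weyl algebra $A_n$ is the $K$-algebra generated by $x_1,\ldots,x_{2n}$ subject to $[x_{n+i},x_j]=\delta_{ij}$ (Kronecker delta), $[x_i,x_j]=[x_{n+i},x_{n+j}]=0$ for $1\le i,j\le n$, where $[a,b]=ab-ba$; $P_m=K[x_{2n+1},\ldots,x_{2n+m}]$ is a polynomial algebra. Then $A=\bigoplus_{\alpha\in\mathbb N^s}Kx^\alpha$, $x^\alpha=x_1^{\alpha_1}\cdots x_s^{\alpha_s}$ (product in this fixed order). The formal partial derivatives $\partial_i=\frac{\partial}{\partial x_i}$ are the commuting locally nilpotent $K$-derivations of $A$ with $\partial_i(x_j)=\delta_{ij}$. Elements of $\widehat A$ are formal (possibly infinite) series $\sum_{\alpha\in\mathbb N^s}a_\alpha\partial^\alpha$, $a_\alpha\in A$, $\partial^\alpha=\partial_1^{\alpha_1}\cdots\partial_s^{\alpha_s}$, multiplied using commuting $\partial_i$'s and the rule $\partial_ia=a\partial_i+\partial_i(a)$, $a\in A$ (well defined because the $\partial_i$ commute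 and are locally nilpotent). A series acts on $A$ by $b\mapsto\sum_\alpha a_\alpha\partial^\alpha(b)$, a finite sum for each $b\in A$; this is the natural homomorphism to the algebra $\mathrm{End}_K(A)$ of all $K$-linear endomorphisms of $A$. *)

(* Defs.v *)
From HB Require Import structures.
From mathcomp Require Import all_boot all_order all_algebra.
From mathcomp Require Import mpoly.
From mathcomp Require Import boolp classical_sets functions cardinality fsbigop.

Set Implicit Arguments.
Unset Strict Implicit.
Unset Printing Implicit Defensive.
Import GRing.Theory.

Local Open Scope ring_scope.
Local Open Scope classical_set_scope.

Definition commutator (R : pzRingType) (a b : R) : R := a * b - b * a.

Definition generates (K : fieldType) (B : algType K) (I : Type) (x : I -> B) :
    Prop :=
  forall S : B -> Prop,
    S 1 ->
    (forall (c : K) a b, S a -> S b -> S (c *: a + b)) ->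
    (forall a b, S a -> S b -> S (a * b)) ->
    (forall i, S (x i)) ->
    forall b, S b.

(* The generators x_1, ..., x_n are [w (lshift n i)] and x_(n+1), ..., x_(2n)
   are [w (rshift n i)], for i : 'I_n. *)
Definition weyl_relations (K : fieldType) (n : nat) (B : algType K)
    (w : 'I_(n + n) -> B) : Prop :=
  forall i j : 'I_n,
    [/\ commutator (w (rshift n i)) (w (lshift n j)) = (i == j)%:R,
        commutator (w (lshift n i)) (w (lshift n j)) = 0
      & commutator (w (rshift n i)) (w (rshift n j)) = 0].

(* [B] is the algebra presented by the generators [w] and the Weyl relations.
   An [algType] is nonzero, so the zero algebra is not among the targets [C];
   the last condition would hold trivially for it. *)
Definition is_weyl_algebra (K : fieldType) (n : nat) (B : algType K)
    (w : 'I_(n + n) -> B) : Prop :=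
  [/\ generates w,
      weyl_relations w
    & forall (C : algType K) (y : 'I_(n + n) -> C), weyl_relations y ->
        exists f : {lrmorphism B -> C}, forall i, f (w i) = y i].

Definition is_bilinear (K : fieldType) (U V W : lmodType K)
    (f : U -> V -> W) : Prop :=
  (forall u, linear (f u)) /\ (forall v, linear (f^~ v)).

Definition is_tensor_product (K : fieldType) (U V W : lmodType K)
    (t : U -> V -> W) : Prop :=
  is_bilinear t /\
  forall (Z : lmodType K) (f : U -> V -> Z), is_bilinear f ->
    exists g : {linear W -> Z},
      (forall u v, g (t u v) = f u v) /\
      (forall h : {linear W -> Z}, (forall u v, h (t u v) = f u v) -> h =1 g).

Definition is_algebra_tensor_product (K : fieldType) (B C A : algType K)
    (t : B -> C -> A) : Prop :=
  [/\ is_tensor_product t,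
      t 1 1 = 1
    & forall b b' c c', t b c * t b' c' = t (b * b') (c * c')].

(* The elements x_1 (x) 1, ..., x_2n (x) 1, 1 (x) x_(2n+1), ...,
   1 (x) x_(2n+m) of A_n (x) P_m. *)
Definition gens (K : fieldType) (n m : nat) (B A : algType K)
    (w : 'I_(n + n) -> B) (t : B -> {mpoly K[m]} -> A) (i : 'I_(n + n + m)) : A :=
  match fintype.split i with
  | inl j => t (w j) 1
  | inr k => t 1 'X_k
  end.

Definition is_derivation (K : fieldType) (A : algType K) (D : {linear A -> A}) :
    Prop :=
  forall a b, D (a * b) = D a * b + a * D b.

(* A derivation is determined by its values on algebra generators, so this
   characterizes [d] whenever [x] generates [A]. *)
Definition are_formal_partials (K : fieldType) (A : algType K) (s : nat)
    (x : 'I_s -> A) (d : 'I_s -> {linear A -> A}) : Prop :=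
  forall i, is_derivation (d i) /\ forall j, d i (x j) = (i == j)%:R.

(* d_1^(alpha_1) o ... o d_s^(alpha_s) *)
Definition partial_pow (K : fieldType) (A : algType K) (s : nat)
    (d : 'I_s -> {linear A -> A}) (alpha : 'X_{1..s}) : A -> A :=
  \big[comp/id]_(i < s) iter (alpha i) (d i).

Definition multi_binomial (s : nat) (alpha beta : 'X_{1..s}) : nat :=
  (\prod_(i < s) 'C(alpha i, beta i))%N.

(* A formal series is the family of its coefficients: [F] stands for
   \sum_alpha F alpha * d^alpha. Addition and scaling are the pointwise ones of
   the function type. *)
Definition series (K : fieldType) (A : algType K) (s : nat) : lmodType K :=
  'X_{1..s} -> A.

Definition series_one (K : fieldType) (A : algType K) (s : nat) :
    series A s :=
  fun alpha => (alpha == 0%MM)%:R.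

(* Moving derivatives to the right with the rule d_i a = a d_i + d_i(a) gives
     d^alpha b
       = \sum_(beta <= alpha) 'C(alpha, beta) d^beta(b) d^(alpha - beta),
   so (a d^alpha) (b d^gamma) contributes 'C(alpha, beta) a d^beta(b) to the
   coefficient of d^delta, for each beta <= alpha with
   alpha - beta + gamma = delta. For fixed delta only finitely many gamma
   occur, alpha is determined by beta and gamma, and d^beta(b) <> 0 for
   finitely many beta since the d_i are commuting and locally nilpotent: the
   finite-support sum, which is 0 by convention on an infinite support, is the
   actual sum. The same applies to [series_act]. *)
Definition series_mul (K : fieldType) (A : algType K) (s : nat)
    (d : 'I_s -> {linear A -> A}) (F G : series A s) : series A s :=
  fun delta =>
    \sum_(p \in [set p : 'X_{1..s} * 'X_{1..s} * 'X_{1..s} |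
            let: (alpha, beta, gamma) := p in
            (beta <= alpha)%MM /\ (alpha - beta + gamma)%MM = delta])
      let: (alpha, beta, gamma) := p in
      (F alpha * partial_pow d beta (G gamma)) *+ multi_binomial alpha beta.

Definition series_act (K : fieldType) (A : algType K) (s : nat)
    (d : 'I_s -> {linear A -> A}) (F : series A s) (b : A) : A :=
  \sum_(alpha \in [set: 'X_{1..s}]) F alpha * partial_pow d alpha b.

(* [Phi] respects the K-algebra structures; that of End_K(A) is pointwise
   addition and scaling, with composition as product. *)
Definition is_algebra_hom_to_End (K : fieldType) (A : algType K) (s : nat)
    (d : 'I_s -> {linear A -> A}) (Phi : series A s -> {linear A -> A}) : Prop :=
  [/\ forall (c : K) (F G : series A s) (b : A),
        Phi (c *: F + G) b = c *: Phi F b + Phi G b,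
      forall b, Phi (@series_one K A s) b = b
    & forall (F G : series A s) (b : A),
        Phi (series_mul d F G) b = Phi F (Phi G b)].

(* Main.v *)
(* The commutators of the generators x_i of A are scalars, so the ordered
   monomials x^alpha span A. The derivations d_i commute and are locally
   nilpotent, since this can be tested on generators, and d^beta(x^alpha)
   vanishes when |beta| >= |alpha| and beta <> alpha, while d^alpha(x^alpha)
   is a nonzero scalar, by characteristic zero. Hence the value of a series F
   at x^alpha is a nonzero multiple of F_alpha plus terms that only involve the
   F_beta with |beta| < |alpha|: a linear map determines the coefficients of a
   series, and any values on the monomials are attained, by recursion on
   |alpha|. Linear independence of the monomials is not needed: two linear maps
   which agree on the spanning monomials are equal. *)
Require Import Defs.
From HB Require Import structures.
From mathcomp Require Import all_boot all_order all_algebra.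
From mathcomp Require Import mpoly.
From mathcomp Require Import boolp classical_sets functions cardinality fsbigop.

Set Implicit Arguments.
Unset Strict Implicit.
Unset Printing Implicit Defensive.

Import GRing.Theory.
Local Open Scope ring_scope.

(** * Derivations on scalars and on powers *)

Section Derivations.
Variables (K : fieldType) (A : algType K).
Implicit Types (D : {linear A -> A}) (a b : A).

Lemma derivation1 D : is_derivation D -> D 1 = 0.
Proof.
move=> derD; have := derD 1 1; rewrite !mulr1 mul1r => /eqP.
by rewrite -subr_eq0 opprD addNKr oppr_eq0 => /eqP.
Qed.

Lemma derivation_scalar D (c : K) : is_derivation D -> D c%:A = 0.
Proof. by move=> derD; rewrite linearZ /= derivation1// scaler0. Qed.

(** [D a] is a scalar, hence central, so the commutative power rule applies; at [k = 0] the
    coefficient is zero and [k.-1] is harmless. *)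
Lemma derivation_expr D a (c : K) k :
  is_derivation D -> D a = c%:A -> D (a ^+ k) = (c *+ k) *: a ^+ k.-1.
Proof.
move=> derD Da; elim: k => [|k IHk].
  by rewrite expr0 derivation1// mulr0n scale0r.
rewrite exprS derD Da IHk -scalerAl mul1r -scalerAr /= mulrS scalerDl.
by congr (_ + _); case: k {IHk} => [|k]; rewrite ?mulr0n ?scale0r// exprS.
Qed.

End Derivations.

(** * Linear spans and ordered monomials *)

Section Span.
Variables (K : fieldType) (V : lmodType K) (I : Type) (v : I -> V).

(** An inductive closure instead of explicit finite sums, so that linear statements on a span follow
    by induction from the family. *)
Inductive in_span : V -> Prop :=
  | in_span0 : in_span 0
  | in_spanP (c : K) u w : in_span u -> in_span w -> in_span (c *: u + w)
  | in_span_base i : in_span (v i).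

Lemma in_spanD u w : in_span u -> in_span w -> in_span (u + w).
Proof. by move=> su sw; rewrite -[u]scale1r; exact: in_spanP. Qed.

Lemma in_spanZ (c : K) u : in_span u -> in_span (c *: u).
Proof. by move=> su; rewrite -[_ *: _]addr0; exact: in_spanP su in_span0. Qed.

End Span.

Section Monomials.
Variables (K : fieldType) (A : algType K) (s : nat) (x : 'I_s -> A).
Implicit Types (al be : 'X_{1..s}) (r : seq 'I_s).

(** An arbitrary list of indices allows induction on the factors; [monomial] is the case of the full
    enumeration. *)
Definition monomial_on r al : A := \prod_(j <- r) x j ^+ al j.
Definition monomial al : A := \prod_(j < s) x j ^+ al j.

Lemma monomial_on_cons k r al :
  monomial_on (k :: r) al = x k ^+ al k * monomial_on r al.
Proof. by rewrite /monomial_on big_cons. Qed.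

Lemma eq_monomial_on r al be :
  {in r, al =1 be} -> monomial_on r al = monomial_on r be.
Proof. by move=> eqr; apply: eq_big_seq => j /eqr ->. Qed.

(** Leibniz along the list; [uniq r] ensures that [U_(j)] changes the exponent of a single
    factor. *)
Lemma derivation_monomial_on (D : {linear A -> A}) (c : 'I_s -> K) r al :
  is_derivation D -> (forall j, D (x j) = (c j)%:A) -> uniq r ->
  D (monomial_on r al) =
    \sum_(j <- r) (c j *+ al j) *: monomial_on r (al - U_(j)).
Proof.
move=> derD Dx; elim: r => [|k r IHr] /=.
  by rewrite /monomial_on !big_nil derivation1.
case/andP=> kr ur; have neq j : j \in r -> (k == j) = false.
  by move=> jr; apply: contraNF kr => /eqP ->.
rewrite big_cons !monomial_on_cons derD (derivation_expr _ derD (Dx k)) IHr//.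
congr (_ + _).
  rewrite -scalerAl mnmBE mnm1E eqxx subn1; congr (_ *: (_ * _)).
  by apply: eq_monomial_on => j jr; rewrite mnmBE mnm1E neq// subn0.
rewrite mulr_sumr; apply: eq_big_seq => j jr; rewrite -scalerAr.
by rewrite monomial_on_cons mnmBE mnm1E eq_sym neq// subn0.
Qed.

Hypothesis comm_x :
  forall i j, exists c : K, commutator (x i) (x j) = c%:A.

(** Move [x i] to the right past each [x k] preceding it in [r]; as commutators are scalars, the
    correction terms are again ordered monomials up to scalars. *)
Lemma in_span_mul_monomial_on i r al : uniq r -> i \in r ->
  in_span (monomial_on r) (x i * monomial_on r al).
Proof.
elim: r al => [|k r IHr] al //= /andP[kr ur].
have neq j : j \in r -> (k == j) = false.
  by move=> jr; apply: contraNF kr => /eqP ->.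
rewrite inE; case: eqVneq => [-> _|ik /= ir].
  rewrite (_ : _ * _ = monomial_on (k :: r) (al + U_(k))); last first.
    rewrite !monomial_on_cons mulrA -exprS mnmDE mnm1E eqxx addn1.
    congr (_ * _); apply: eq_monomial_on => j jr.
    by rewrite mnmDE mnm1E neq// addn0.
  exact: in_span_base.
have [c cE] := comm_x i k.
(* Since [k] is not in [r], its exponent can be set freely without changing the remaining
   factors. *)
have powk be (a : nat) : x k ^+ a * monomial_on r be =
    monomial_on (k :: r) [multinom if j == k then a else be j | j < s].
  rewrite monomial_on_cons mnmE eqxx; congr (_ * _).
  by apply: eq_monomial_on => j jr; rewrite mnmE eq_sym neq.
(* Induction on the exponent: [[x_i, x_k^a] = c a x_k^(a-1)], because [c] is central. *)
have xx a : x i * x k ^+ a = x k ^+ a * x i + (c *+ a) *: x k ^+ a.-1.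
  elim: a => [|a IHa]; first by rewrite expr0 mulr1 mul1r mulr0n scale0r addr0.
  have /eqP := cE; rewrite /commutator subr_eq => /eqP xik.
  rewrite [in LHS]exprS mulrA xik mulrDl -[x k * _ * _]mulrA IHa mulrDr.
  rewrite mulrA -exprS -scalerAl mul1r -scalerAr addrC -addrA; congr (_ + _).
  rewrite mulrSr scalerDl; congr (_ + _).
  by case: a {IHa} => [|a]; rewrite ?mulr0n ?scale0r// exprS.
rewrite monomial_on_cons mulrA xx mulrDl.
apply: in_spanD.
  rewrite -mulrA; elim: (IHr al ur ir) => [|c' u w _ su _ sw|be].
  - by rewrite mulr0; exact: in_span0.
  - by rewrite mulrDr -scalerAr; exact: in_spanP.
  - by rewrite powk; exact: in_span_base.
by rewrite -scalerAl; apply: in_spanZ; rewrite powk; exact: in_span_base.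
Qed.

Hypothesis gen_x : generates x.

(** The elements whose left multiplication preserves the span form a subalgebra containing the
    generators; apply this to the monomial [1]. *)
Lemma monomials_span a : in_span monomial a.
Proof.
suff H : forall b, in_span monomial b -> in_span monomial (a * b).
  rewrite -[a]mulr1; apply: H.
  rewrite (_ : 1 = monomial 0%MM); first exact: in_span_base.
  by rewrite /monomial big1// => j _; rewrite mnm0E expr0.
move: a; apply: gen_x.
- by move=> b; rewrite mul1r.
- move=> c a1 a2 H1 H2 b sb; rewrite mulrDl -scalerAl.
  by apply: in_spanP; [exact: H1 | exact: H2].
- by move=> a1 a2 H1 H2 b sb; rewrite -mulrA; apply/H1/H2.
- move=> i b; elim=> [|c u w _ su _ sw|be].
  + by rewrite mulr0; exact: in_span0.
  + by rewrite mulrDr -scalerAr; exact: in_spanP.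
  + apply: in_span_mul_monomial_on; first exact: index_enum_uniq.
    exact: mem_index_enum.
Qed.

End Monomials.

(** A nonzero multi-index dominates some [U_(i)], and subtracting it lowers the degree by one. *)
Lemma multinom_ind s (P : 'X_{1..s} -> Prop) :
  P 0%MM -> (forall al i, P al -> P (al + U_(i))%MM) -> forall al, P al.
Proof.
move=> P0 PS al; move: {2}(mdeg al) (erefl (mdeg al)) => k.
elim: k al => [|k IHk] al; first by move/eqP; rewrite mdeg_eq0 => /eqP ->.
move=> dal; have [i ali] : exists i, (U_(i) <= al)%MM.
  apply/existsP; apply: contra_eqT dal => /existsPn al0.
  rewrite (_ : al = 0%MM) ?mdeg0//; apply/mnmP=> i; rewrite mnm0E.
  by have := al0 i; rewrite lep1mP negbK => /eqP.
rewrite -(submK ali); apply/PS/IHk.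
by apply/eqP; rewrite -eqSS -dal -{2}(submK ali) mdegD mdeg1 addn1.
Qed.

(** * Pure tensors and the generators of the tensor product *)

Section SpanSubmodule.
Variables (K : fieldType) (W : lmodType K) (I : Type) (v : I -> W).

Definition span_pred : {pred W} := fun a => `[< in_span v a >].

Lemma span_pred_submod_closed : submod_closed span_pred.
Proof.
split; first by apply/asboolP; exact: in_span0.
by move=> c u z /asboolP su /asboolP sz; apply/asboolP; exact: in_spanP.
Qed.

HB.instance Definition _ :=
  GRing.isSubmodClosed.Build K W span_pred
    (GRing.submod_closed_semi span_pred_submod_closed).

(** The span as a vector space of its own, so that it can be a target of the universal property. *)
Record span_sub := SpanSub { span_val : W; _ : span_val \in span_pred }.

HB.instance Definition _ := [isSub for span_val].
HB.instance Definition _ := [Choice of span_sub by <:].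
HB.instance Definition _ := [SubChoice_isSubLmodule of span_sub by <:].

End SpanSubmodule.

(* The universal property gives a map into the span of the pure tensors whose
   composition with the inclusion must be the identity. *)
Lemma pure_tensors_span (K : fieldType) (U V W : lmodType K)
    (t : U -> V -> W) (a : W) :
  is_tensor_product t -> in_span (fun p => t p.1 p.2) a.
Proof.
move=> [[tl tr] univ]; set v := fun p => _.
have tv u z : t u z \in span_pred v.
  by apply/asboolP; exact: (in_span_base v (u, z)).
pose f u z : span_sub v := SpanSub (tv u z).
have [|g [gf _]] := univ (span_sub v : lmodType K) f.
  split=> [u|z] c a1 a2; apply: val_inj; rewrite linearP /=.
    exact: tl.
  exact: tr.
have [|h [hf uniq_h]] := univ W t; first by split.
have e1 := uniq_h (val \o g) (fun u z => congr1 val (gf u z)).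
have e2 := uniq_h idfun (fun u z => erefl).
by rewrite -[a]/(idfun a) e2 -e1; apply/asboolP; exact: (valP (g a)).
Qed.

Section TensorGenerators.
Variables (K : fieldType) (n m : nat) (An : algType K) (w : 'I_(n + n) -> An).
Variables (A : algType K) (t : An -> {mpoly K[m]} -> A).
Hypothesis tensA : is_algebra_tensor_product t.

Let tl c u u' p : t (c *: u + u') p = c *: t u p + t u' p.
Proof. by case: tensA => -[[_ h]] _ _ _; exact: h. Qed.

Let tr c u p p' : t u (c *: p + p') = c *: t u p + t u p'.
Proof. by case: tensA => -[[h _]] _ _ _; exact: h. Qed.

Let t11 : t 1 1 = 1. Proof. by case: tensA. Qed.

Let tM u u' p p' : t u p * t u' p' = t (u * u') (p * p').
Proof. by case: tensA. Qed.

(** A subalgebra containing the generators contains all [t u 1] and all [t 1 p], hence their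
    products [t u p], which span. *)
Lemma gens_generate : generates w -> generates (gens w t).
Proof.
move=> genw S S1 SP SM Sx a.
have S0 : S 0 by rewrite -(addNr 1) -scaleN1r; exact: SP.
have Sl u : S (t u 1).
  apply: (genw (fun u => S (t u 1))) => //.
  - by rewrite t11.
  - by move=> c u1 u2 S1' S2; rewrite tl; exact: SP.
  - by move=> u1 u2 S1' S2; rewrite -[1]mulr1 -tM; exact: SM.
  - move=> i; have := Sx (lshift m i).
    by rewrite /gens -[lshift m i]/(unsplit (inl i)) unsplitK.
have SX al : S (t 1 'X_[al]).
  elim/multinom_ind: al => [|al i Sal]; first by rewrite mpolyX0 t11.
  rewrite mpolyXD -[1]mulr1 -tM; apply: SM => //.
  have := Sx (rshift _ i).
  by rewrite /gens -[rshift _ i]/(unsplit (inr i)) unsplitK.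
have Sr p : S (t 1 p).
  rewrite (mpolyE p); elim/big_rec: _ => [|al q _ Sq].
    have /eqP := tr 1 1 0 0.
    by rewrite !scale1r add0r -subr_eq0 opprD addNKr oppr_eq0 => /eqP ->.
  by rewrite tr; exact: SP.
case: tensA => tens _ _.
elim: (pure_tensors_span a tens) => [//|c u z _ Su _ Sz|[u p] /=].
  exact: SP.
by rewrite -[u]mulr1 -[p]mul1r -tM; exact: SM.
Qed.

(** Within [An] the Weyl relations give scalars; all other pairs of generators commute. *)
Lemma gens_comm i j : weyl_relations w ->
  exists c : K, commutator (gens w t i) (gens w t j) = c%:A.
Proof.
move=> rel; rewrite /commutator /gens.
have t0 p : t 0 p = 0.
  have /eqP := tl 1 0 0 p.
  by rewrite !scale1r add0r -subr_eq0 opprD addNKr oppr_eq0 => /eqP.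
have c0 (a : A) : a = 0 -> exists c : K, a = c%:A.
  by exists 0; rewrite scale0r.
case: (fintype.split i) => [k|k]; case: (fintype.split j) => [l|l];
  rewrite !tM ?mulr1 ?mul1r.
- have -> : t (w k * w l) 1 - t (w l * w k) 1 = t (commutator (w k) (w l)) 1.
    by rewrite addrC -scaleN1r -tl scaleN1r addrC.
  suff [c ->] : exists c : K, commutator (w k) (w l) = c%:A.
    by exists c; rewrite -[c *: 1]addr0 tl t0 addr0 t11.
  (* The mixed relations are given in one order only; antisymmetry supplies the other. *)
  have cN (a b : An) : (exists c : K, commutator a b = c%:A) ->
      exists c : K, commutator b a = c%:A.
    by move=> [c ab]; exists (- c); rewrite scaleNr -ab /commutator opprB.
  rewrite -[k]splitK -[l]splitK.
  case: (fintype.split k) => [k'|k']; case: (fintype.split l) => [l'|l'] /=.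
  + by have [_ -> _] := rel k' l'; exists 0; rewrite scale0r.
  + apply: cN; have [-> _ _] := rel l' k'.
    by exists (l' == k')%:R; rewrite scaler_nat.
  + have [-> _ _] := rel k' l'.
    by exists (k' == l')%:R; rewrite scaler_nat.
  + by have [_ _ ->] := rel k' l'; exists 0; rewrite scale0r.
- by apply: c0; rewrite subrr.
- by apply: c0; rewrite subrr.
- by apply: c0; rewrite mulrC subrr.
Qed.

End TensorGenerators.

(** The commutator of two derivations is a derivation, so it vanishes as soon as it vanishes on
    generators. *)
Lemma derivations_commute (K : fieldType) (A : algType K) (I : Type)
    (x : I -> A) (D E : {linear A -> A}) :
  generates x -> is_derivation D -> is_derivation E ->
  (forall i, D (E (x i)) = E (D (x i))) -> forall a, D (E a) = E (D a).
Proof.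
move=> genx derD derE DEx; apply: genx => //.
- by rewrite (derivation1 derD) (derivation1 derE) !linear0.
- by move=> c a b Da Db; rewrite !linearP Da Db.
move=> a b Da Db; rewrite derE derD !linearD !derD !derE Da Db -!addrA.
by congr (_ + _); rewrite addrCA.
Qed.

(** * Multi-indices of bounded degree and their binomial coefficients *)

Section Multinomials.
Variable s : nat.
Implicit Types (al be ga : 'X_{1..s}).

Definition multinom_seq N : seq 'X_{1..s} :=
  [seq bmnm be | be : 'X_{1..s < N}].

Lemma mem_multinom_seq N al : (al \in multinom_seq N) = (mdeg al < N)%N.
Proof.
apply/fintype.imageP/idP => [[be _ ->]|ltal]; first exact: bmdeg.
by exists (BMultinom ltal).
Qed.

Lemma multinom_seq_uniq N : uniq (multinom_seq N).
Proof. by rewrite map_inj_uniq ?enum_uniq//; exact: val_inj. Qed.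

Lemma multi_binomial_eq0 al be :
  ~~ (be <= al)%MM -> multi_binomial al be = 0%N.
Proof.
rewrite negb_forall => /existsP[i]; rewrite -ltnNge => lti.
by rewrite /multi_binomial (bigD1 i)//= bin_small.
Qed.

(** Pascal's rule in coordinate [i]; the guard excludes [be i = 0], where the truncated [be - U_(i)]
    would be [be] itself. *)
Lemma multi_binomialS al be i :
  multi_binomial (al + U_(i)) be =
  (multi_binomial al be +
   if (U_(i) <= be)%MM then multi_binomial al (be - U_(i)) else 0)%N.
Proof.
rewrite /multi_binomial lep1mP (bigD1 i)//= [in RHS](bigD1 i)//=.
rewrite mnmDE mnm1E eqxx addn1.
have -> : (\prod_(j < s | j != i) 'C((al + U_(i))%MM j, be j) =
           \prod_(j < s | j != i) 'C(al j, be j))%N.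
  by apply: eq_bigr => j ji; rewrite mnmDE mnm1E eq_sym (negPf ji) addn0.
case: (eqVneq (be i) 0%N) => [->|bei] /=; first by rewrite !bin0 addn0.
rewrite [X in (_ + X)%N](bigD1 i)//= mnmBE mnm1E eqxx subn1.
have -> : (\prod_(j < s | j != i) 'C(al j, (be - U_(i))%MM j) =
           \prod_(j < s | j != i) 'C(al j, be j))%N.
  by apply: eq_bigr => j ji; rewrite mnmBE mnm1E eq_sym (negPf ji) subn0.
by rewrite -mulnDl; case: (be i) bei => // k _; rewrite binS.
Qed.

Lemma multi_binomial0 be : multi_binomial 0 be = (be == 0%MM).
Proof.
case: eqVneq => [->|be0].
  by rewrite /multi_binomial big1// => i _; rewrite mnm0E.
rewrite multi_binomial_eq0//; apply: contra be0 => /mnm_lepP le0.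
by apply/eqP/mnmP=> i; have := le0 i; rewrite mnm0E leqn0 => /eqP.
Qed.

Lemma sum_multinom_shift (V : nmodType) N i (f : 'X_{1..s} -> V) :
  \sum_(be <- multinom_seq N.+1 | (U_(i) <= be)%MM) f be =
  \sum_(be <- multinom_seq N) f (be + U_(i))%MM.
Proof.
rewrite -[RHS](big_map (fun be => (be + U_(i))%MM) xpredT f).
rewrite -[LHS]big_filter; apply/perm_big/uniq_perm.
- by rewrite filter_uniq// multinom_seq_uniq.
- by rewrite map_inj_uniq ?multinom_seq_uniq//; exact: addIm.
move=> al; rewrite mem_filter mem_multinom_seq.
apply/andP/mapP => [[le_al deg_al]|[be]].
  exists (al - U_(i))%MM; last by rewrite submK.
  by rewrite mem_multinom_seq -ltnS -(addn1 (mdeg _)) -(mdeg1 i) -mdegD submK.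
by rewrite mem_multinom_seq => ltbe ->; rewrite lem_addl mdegD mdeg1 addn1.
Qed.

End Multinomials.

(** * Iterated partial derivatives: Leibniz rule and local nilpotency *)

Section CommutingDerivations.
Variables (K : fieldType) (A : algType K) (s : nat).
Variable d : 'I_s -> {linear A -> A}.
Implicit Types (al be ga : 'X_{1..s}) (a b : A).

Lemma partial_pow_linear al : linear (partial_pow d al).
Proof.
rewrite /partial_pow => c a b.
elim: (index_enum _) => [|k r IHr]; first by rewrite !big_nil.
rewrite !big_cons /= IHr; elim: (al k) => //= m ->; exact: linearP.
Qed.

HB.instance Definition _ al :=
  GRing.isLinear.Build K A A *:%R (partial_pow d al) (partial_pow_linear al).

Lemma partial_pow0 a : partial_pow d 0 a = a.
Proof.
rewrite /partial_pow; elim: (index_enum _) => [|k r IHr].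
  by rewrite big_nil.
by rewrite big_cons /= mnm0E IHr.
Qed.

Hypothesis derd : forall i, is_derivation (d i).
Hypothesis commd : forall i j a, d i (d j a) = d j (d i a).

Let iter_comm i j p q a :
  iter p (d i) (iter q (d j) a) = iter q (d j) (iter p (d i) a).
Proof.
have c1 b : d i (iter q (d j) b) = iter q (d j) (d i b).
  by elim: q b => //= q IHq b; rewrite commd IHq.
by elim: p => //= p ->; exact: c1.
Qed.

Lemma partial_powD al be a :
  partial_pow d (al + be) a = partial_pow d al (partial_pow d be a).
Proof.
rewrite /partial_pow; elim: (index_enum _) => [|k r IHr].
  by rewrite !big_nil.
rewrite !big_cons /= IHr mnmDE iterD; congr (iter _ _ _).
move: {IHr}((\big[comp/id]_(i <- r) iter (be i) (d i)) a) => {}a.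
elim: r => [|l r IHr]; first by rewrite !big_nil.
by rewrite !big_cons /= iter_comm IHr.
Qed.

Lemma partial_pow1 i a : partial_pow d U_(i) a = d i a.
Proof.
rewrite /partial_pow.
have : uniq (index_enum 'I_s) by exact: index_enum_uniq.
have : i \in index_enum 'I_s by exact: mem_index_enum.
elim: (index_enum _) => [//|k r IHr].
rewrite inE big_cons /= mnm1E; case: eqVneq => [-> _|ik /= ir] /andP[kr ur] /=.
  congr (d k _); elim: r kr {IHr ur} => [|l r IHr]; first by rewrite big_nil.
  rewrite inE negb_or => /andP[kl kr]; rewrite big_cons /= mnm1E (negPf kl).
  exact: IHr.
exact: IHr.
Qed.

Lemma partial_pow1D i al a :
  partial_pow d (al + U_(i)) a = partial_pow d al (d i a).
Proof. by rewrite partial_powD partial_pow1. Qed.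

(** Induction on [al] with Pascal's rule. Any [N] above the degree will do, since the binomial
    coefficient vanishes unless [be <= al]. *)
Lemma partial_pow_Leibniz N al a b : (mdeg al < N)%N ->
  partial_pow d al (a * b) =
  \sum_(be <- multinom_seq s N)
    (partial_pow d be a * partial_pow d (al - be) b) *+ multi_binomial al be.
Proof.
elim/multinom_ind: al N a b => [|al i IHal] [//|N] a b ltN.
  rewrite (bigD1_seq 0%MM) ?multinom_seq_uniq ?mem_multinom_seq ?mdeg0//=.
  rewrite big1 => [|be be0]; rewrite multi_binomial0 ?(negPf be0)//.
  by rewrite eqxx subm0 !partial_pow0 addr0.
rewrite partial_pow1D derd linearD /=.
have ltal : (mdeg al < N)%N by move: ltN; rewrite mdegD mdeg1 addn1.
(* The expansion with [d i a] stops at [N], as its index is later shifted by [U_(i)] into the range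
   below [N.+1]. *)
rewrite (IHal N (d i a) b ltal) (IHal N.+1 a (d i b) (ltnW ltal)).
under [in RHS]eq_bigr do rewrite multi_binomialS mulrnDr.
rewrite big_split /= [LHS]addrC; congr (_ + _).
  apply: eq_bigr => be _; rewrite -partial_pow1D.
  have [le_be|/multi_binomial_eq0 ->] := boolP (be <= al)%MM; last first.
    by rewrite !mulr0n.
  by congr (_ * partial_pow d _ b *+ _); rewrite addmC addmBA// addmC.
under [in RHS]eq_bigr => be _.
  rewrite (_ : _ *+ _ = if (U_(i) <= be)%MM then
    (partial_pow d be a * partial_pow d (al + U_(i) - be) b)
      *+ multi_binomial al (be - U_(i)) else 0); last by case: ifP.
  over.
rewrite -big_mkcond sum_multinom_shift; apply: eq_bigr => be _.
rewrite addmK partial_pow1D; congr (_ * partial_pow d _ b *+ _).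
by apply/mnmP=> j; rewrite !(mnmBE, mnmDE) subnDr.
Qed.

(** One bound on the total order of all mixed derivatives, so that sums over multi-indices can be
    cut off by degree. *)
Definition nilpotent_at N a :=
  forall al, (N <= mdeg al)%N -> partial_pow d al a = 0.

(** In each Leibniz term the orders of the two derivatives add up to at least [N + M], so one factor
    vanishes. *)
Lemma nilpotent_atM N M a b :
  nilpotent_at N a -> nilpotent_at M b -> nilpotent_at (N + M) (a * b).
Proof.
move=> nila nilb al leal; rewrite (partial_pow_Leibniz _ _ (ltnSn _)).
rewrite big1 // => be _.
have [le_be|/multi_binomial_eq0 ->] := boolP (be <= al)%MM; last first.
  by rewrite mulr0n.
have [leN|ltN] := leqP N (mdeg be); first by rewrite nila// mul0r mul0rn.
rewrite nilb ?mulr0 ?mul0rn//.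
move: leal; rewrite -{1}(submK le_be) mdegD => leal.
by rewrite -(leq_add2r N) addnC (leq_trans leal)// leq_add2l ltnW.
Qed.

(** Elements admitting a bound form a subalgebra, and generators are killed by all derivatives of
    order at least two. *)
Lemma locally_nilpotent (I : Type) (x : I -> A) :
  generates x -> (forall i j, exists c : K, d i (x j) = c%:A) ->
  forall a, exists N, nilpotent_at N a.
Proof.
move=> genx dx.
have nil1 : nilpotent_at 1 1.
  elim/multinom_ind => [|al i _ _]; first by rewrite mdeg0.
  by rewrite partial_pow1D (derivation1 (derd i)) linear0.
apply: genx.
- by exists 1%N.
- move=> c a b [N nila] [M nilb]; exists (N + M)%N => al leal.
  rewrite linearP /= nila ?nilb ?scaler0 ?addr0//.
    exact: leq_trans (leq_addl _ _) leal.
  exact: leq_trans (leq_addr _ _) leal.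
- move=> a b [N nila] [M nilb]; exists (N + M)%N; exact: nilpotent_atM.
move=> j; exists 2; elim/multinom_ind => [|al i _]; first by rewrite mdeg0.
rewrite mdegD mdeg1 addn1 ltnS partial_pow1D => leal.
by have [c ->] := dx i j; rewrite linearZ /= nil1// scaler0.
Qed.

End CommutingDerivations.

(** Bundled linear maps also carry proofs, identified by proof irrelevance; bijectivity onto the
    endomorphisms needs equality of these bundles. *)
Lemma eq_linear (K : fieldType) (U V : lmodType K) (f g : {linear U -> V}) :
  f =1 g -> f = g.
Proof.
case: f => f [[f1] [f2]]; case: g => g [[g1] [g2]] /= /funext fg.
subst g; congr (GRing.Linear.Pack (GRing.Linear.Class _ _)); congr (_ _);
  exact: Prop_irrelevance.
Qed.

(** * The action of series is an algebra homomorphism *)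

Section SeriesAction.
Variables (K : fieldType) (A : algType K) (s : nat).
Variable d : 'I_s -> {linear A -> A}.
Hypothesis derd : forall i, is_derivation (d i).
Hypothesis commd : forall i j a, d i (d j a) = d j (d i a).
Hypothesis nild : forall a, exists N, nilpotent_at d N a.
Implicit Types (al be ga : 'X_{1..s}) (a b : A) (F G : series A s).

Lemma nilpotent_at_le N M a :
  (N <= M)%N -> nilpotent_at d N a -> nilpotent_at d M a.
Proof. by move=> leNM nila al leM; apply: nila; exact: leq_trans leM. Qed.

Lemma series_actE N F b : nilpotent_at d N b ->
  series_act d F b = \sum_(al <- multinom_seq s N) F al * partial_pow d al b.
Proof.
move=> nilb; rewrite [RHS](bigfs _ (multinom_seq_uniq s N)).
  by apply: eq_fsbigl; apply/seteqP.
by move=> al _; rewrite mem_multinom_seq -leqNgt => /nilb ->; rewrite mulr0.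
Qed.

Lemma series_act_linear F : linear (series_act d F).
Proof.
move=> c a b; have [N nila] := nild a; have [M nilb] := nild b.
have leN := leq_addr M N; have leM := leq_addl N M.
have nila' := nilpotent_at_le leN nila; have nilb' := nilpotent_at_le leM nilb.
rewrite (series_actE F nila') (series_actE F nilb') (@series_actE (N + M)).
  rewrite scaler_sumr -big_split; apply: eq_bigr => al _ /=.
  by rewrite linearP mulrDr -scalerAr.
by move=> al leal; rewrite linearP /= nila' ?nilb'// scaler0 addr0.
Qed.

(** A contributing triple has [|ga| <= |de| < N], then [|be| < M] as otherwise the derivative of
    [G ga] vanishes, and [|al| <= |be| + |de| < M + N]. These boxes therefore contain the
    support. *)
Lemma series_mulE N M F G de :
  (forall ga, (mdeg ga < N)%N -> nilpotent_at d M (G ga)) -> (mdeg de < N)%N ->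
  series_mul d F G de =
  \sum_(al <- multinom_seq s (M + N)) \sum_(be <- multinom_seq s (M + N))
    \sum_(ga <- multinom_seq s N)
      if (be <= al)%MM && (al - be + ga == de)%MM then
        (F al * partial_pow d be (G ga)) *+ multi_binomial al be
      else 0.
Proof.
move=> nilG ltde; set r := multinom_seq s (M + N); set r' := multinom_seq s N.
transitivity (\sum_(p <- [seq (p, ga) | p <- [seq (al, be) | al <- r, be <- r],
                                        ga <- r'] |
      (p.1.2 <= p.1.1)%MM && (p.1.1 - p.1.2 + p.2 == de)%MM)
    (F p.1.1 * partial_pow d p.1.2 (G p.2)) *+ multi_binomial p.1.1 p.1.2).
  rewrite [RHS]bigfs; first 1 last.
  - do 2?apply: allpairs_uniq; rewrite ?multinom_seq_uniq//; by move=> [? ?] [? ?].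
  - move=> [[al be] ga] /= /andP[le_be /eqP dE].
    have ltga : (mdeg ga < N)%N.
      by apply: leq_ltn_trans ltde; rewrite -dE mdegD leq_addl.
    have [leM _|ltM] := leqP M (mdeg be); first by rewrite nilG// mulr0 mul0rn.
    case/negP; apply/allpairsP; exists ((al, be), ga); split=> //=; last first.
      by rewrite mem_multinom_seq.
    apply/allpairsP; exists (al, be); split=> //=; rewrite mem_multinom_seq.
      rewrite -(submK le_be) mdegD addnC -addSn leq_add// ltnW//.
      by apply: leq_ltn_trans ltde; rewrite -dE mdegD leq_addr.
    exact: leq_trans ltM (leq_addr _ _).
  have setE : [set p : 'X_{1..s} * 'X_{1..s} * 'X_{1..s} |
        let: (al, be, ga) := p in
        (be <= al)%MM /\ (al - be + ga)%MM = de]%classic =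
      [set` fun p : 'X_{1..s} * 'X_{1..s} * 'X_{1..s} =>
        (p.1.2 <= p.1.1)%MM && (p.1.1 - p.1.2 + p.2 == de)%MM]%classic.
    apply/seteqP; split=> -[[al be] ga] /=.
      by case=> le_be dE; apply/andP; split=> //; apply/eqP.
    by case/andP=> le_be /eqP.
  by rewrite /series_mul setE; apply: eq_fsbigr => -[[al be] ga].
by rewrite big_mkcond big_allpairs_dep big_allpairs_dep.
Qed.

(** With all sums cut off, the sum over [de] collapses to [de = al - be + ga]; what remains is the
    Leibniz rule for [d^al] on [G ga * d^ga(b)]. *)
Lemma series_act_mul F G b :
  series_act d (series_mul d F G) b = series_act d F (series_act d G b).
Proof.
have [N nilb] := nild b; have [nu nilnu] := choice nild.
(* Only the finitely many [G ga] with [|ga| < N] meet a nonzero derivative of [b], so one bound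
   serves them all. *)
pose M := \max_(ga <- multinom_seq s N) nu (G ga).
have nilG ga : (mdeg ga < N)%N -> nilpotent_at d M (G ga).
  move=> ltga; apply: nilpotent_at_le (nilnu _).
  by apply: leq_bigmax_seq; rewrite ?mem_multinom_seq.
(* Each term of [G] applied to [b] multiplies [G ga], killed from order [M] on, by a derivative of
   [b], killed from order [N] on; hence the bound [M + N]. *)
rewrite (series_actE _ nilb) (series_actE G nilb) (@series_actE (M + N)); last first.
  move=> al leal; rewrite linear_sum big1_seq// => ga.
  rewrite mem_multinom_seq => /= ltga; apply: (nilpotent_atM derd commd) leal.
    exact: nilG.
  move=> be lebe; rewrite -partial_powD// nilb// mdegD.
  exact: leq_trans lebe (leq_addr _ _).
transitivity (\sum_(al <- multinom_seq s (M + N))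
  \sum_(be <- multinom_seq s (M + N)) \sum_(ga <- multinom_seq s N)
    (F al * partial_pow d be (G ga) * partial_pow d (al - be + ga) b)
      *+ multi_binomial al be).
  rewrite big_seq; under eq_bigr => de inde.
    have ltde : (mdeg de < N)%N by rewrite -mem_multinom_seq.
    rewrite (series_mulE _ nilG ltde) mulr_suml.
    under eq_bigr do (rewrite mulr_suml; under eq_bigr do rewrite mulr_suml).
    over.
  rewrite -big_seq exchange_big; apply: eq_bigr => al _.
  rewrite exchange_big; apply: eq_bigr => be _.
  rewrite exchange_big; apply: eq_bigr => ga _ /=.
  have [le_be|/multi_binomial_eq0 ->] := boolP (be <= al)%MM; last first.
    by rewrite mulr0n big1// => de _; rewrite mul0r.
  (* Either exactly one [de] in range matches, or none does and the derivative of [b] on the other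
     side is zero. *)
  have [ltN|leN] := ltnP (mdeg (al - be + ga)) N.
    rewrite (bigD1_seq (al - be + ga)%MM) ?multinom_seq_uniq//=; last first.
      by rewrite mem_multinom_seq.
    rewrite eqxx big1 ?addr0 ?mulrnAl// => de /negPf.
    by rewrite eq_sym => ->; rewrite mul0r.
  rewrite nilb// mulr0 mul0rn big1_seq// => de; rewrite mem_multinom_seq => ltde.
  case: eqP => [eqde|]; rewrite ?mul0r//.
  by move: ltde; rewrite -eqde ltnNge leN.
apply: eq_big_seq => al; rewrite mem_multinom_seq => ltal.
rewrite linear_sum mulr_sumr exchange_big; apply: eq_bigr => ga _ /=.
rewrite (partial_pow_Leibniz derd commd _ _ ltal) mulr_sumr.
by apply: eq_bigr => be _; rewrite mulrnAr -partial_powD// mulrA.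
Qed.

Lemma series_act1 b : series_act d (@series_one K A s) b = b.
Proof.
have [N nilb] := nild b; have nilb' := nilpotent_at_le (leqnSn N) nilb.
rewrite (series_actE _ nilb') (bigD1_seq 0%MM) ?multinom_seq_uniq//=; last first.
  by rewrite mem_multinom_seq mdeg0.
rewrite /series_one eqxx mul1r partial_pow0 big1 ?addr0// => al /negPf ->.
by rewrite mul0r.
Qed.

Lemma series_actP (c : K) F G b :
  series_act d (c *: F + G) b = c *: series_act d F b + series_act d G b.
Proof.
have [N nilb] := nild b; rewrite !(series_actE _ nilb) scaler_sumr -big_split.
by apply: eq_bigr => al _; rewrite /= scalerAl -mulrDl.
Qed.

(** * Values of series on monomials: injectivity and surjectivity *)

Section Monomials.
Variable x : 'I_s -> A.
Hypothesis charK0 : [pchar K] =i pred0.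
Hypothesis dx : forall i j, d i (x j) = (i == j)%:R.
Hypothesis span_x : forall a, in_span (monomial x) a.

(** If [al i = 0], the truncated [al - U_(i)] is [al], but the coefficient is zero. *)
Lemma partial_monomial i al :
  d i (monomial x al) = (al i)%:R *: monomial x (al - U_(i)).
Proof.
rewrite [LHS](@derivation_monomial_on _ _ _ x _ (fun j => (i == j)%:R))//.
- rewrite (bigD1_seq i) ?mem_index_enum ?index_enum_uniq//= eqxx big1 ?addr0//.
  by move=> j /negPf; rewrite eq_sym => ->; rewrite mul0rn scale0r.
- by move=> j; rewrite dx scaler_nat.
- exact: index_enum_uniq.
Qed.

(** Each [d i] either kills the monomial or lowers both multi-indices by [U_(i)], preserving both
    hypotheses. *)
Lemma partial_pow_monomial_eq0 al be :
  (mdeg al <= mdeg be)%N -> al != be -> partial_pow d be (monomial x al) = 0.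
Proof.
elim/multinom_ind: be al => [|be i IHbe] al.
  by rewrite mdeg0 leqn0 mdeg_eq0 => /eqP -> /eqP.
rewrite partial_pow1D// partial_monomial linearZ /=.
case: (eqVneq (al i) 0%N) => [-> _ _|]; first by rewrite scale0r.
rewrite -lep1mP => leal; rewrite -{1 2}(submK leal) !mdegD leq_add2r.
by rewrite (can_eq (addmK _)) => /IHbe H /H ->; rewrite scaler0.
Qed.

(** The scalar built here is the product of the factorials of the exponents, nonzero in
    characteristic zero. *)
Lemma partial_pow_monomial_diag al :
  exists2 c : K, c != 0 & partial_pow d al (monomial x al) = c%:A.
Proof.
elim/multinom_ind: al => [|al i [c c0 IHal]].
  exists 1; rewrite ?oner_eq0// partial_pow0 scale1r /monomial big1// => j _.
  by rewrite mnm0E expr0.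
exists ((al i).+1%:R * c).
  by rewrite mulf_neq0//; have /pcharf0P -> := charK0.
rewrite partial_pow1D// partial_monomial mnmDE mnm1E eqxx addn1 addmK.
by rewrite linearZ /= IHal scalerA.
Qed.

(** In degree [|al|] only [be = al] survives, so the equations for the coefficients are triangular
    with respect to degree. *)
Lemma series_act_monomial F al (c : K) :
  partial_pow d al (monomial x al) = c%:A ->
  series_act d F (monomial x al) = c *: F al +
    \sum_(be <- multinom_seq s (mdeg al))
      F be * partial_pow d be (monomial x al).
Proof.
move=> alE; rewrite (@series_actE (mdeg al).+1); last first.
  move=> be ltbe; rewrite partial_pow_monomial_eq0// ?(ltnW ltbe)//.
  by apply: contraTneq ltbe => ->; rewrite ltnn.
rewrite (bigD1_seq al) ?multinom_seq_uniq ?mem_multinom_seq//= alE.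
rewrite -scalerAr mulr1; congr (_ + _).
transitivity (\sum_(be <- multinom_seq s (mdeg al).+1 | (mdeg be < mdeg al)%N)
    F be * partial_pow d be (monomial x al)).
  rewrite big_mkcond [RHS]big_mkcond; apply: eq_bigr => be _.
  have [ltbe|lebe] := ltnP; last first.
    case: eqVneq => [//|ne].
    by rewrite partial_pow_monomial_eq0 ?mulr0// eq_sym.
  by case: eqVneq ltbe => [->|//]; rewrite ltnn.
rewrite -[LHS]big_filter; apply/perm_big/uniq_perm.
- by rewrite filter_uniq ?multinom_seq_uniq.
- exact: multinom_seq_uniq.
by move=> be; rewrite mem_filter !mem_multinom_seq andb_idr// => /ltnW.
Qed.

(** Strong induction on degree: once the lower coefficients agree, the values at [x^al] give
    [c *: F al = c *: G al] with [c] nonzero. *)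
Lemma series_act_inj F G : series_act d F =1 series_act d G -> F = G.
Proof.
move=> FG; apply/funext => al.
move: {2}(mdeg al).+1 (ltnSn (mdeg al)) => k; elim: k al => // k IHk al ltal.
have [c c0 alE] := partial_pow_monomial_diag al.
have := FG (monomial x al); rewrite !(series_act_monomial _ alE).
rewrite (eq_big_seq (fun be => G be * partial_pow d be (monomial x al))).
  by move=> /addIr /(scalerI c0).
by move=> be; rewrite mem_multinom_seq => ltbe; rewrite IHk ?(leq_trans ltbe).
Qed.

Lemma series_act_surj (phi : {linear A -> A}) :
  exists F, forall a, series_act d F a = phi a.
Proof.
have [c cP] := choice (fun al => let: ex_intro2 c c0 cE :=
  partial_pow_monomial_diag al in ex_intro _ c (conj c0 cE)).
(* Coefficients of degree below [k] are kept; the others solve the triangular equation from the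
   current [R], which makes those of degree exactly [k] final. *)
pose step k (R : series A s) : series A s := fun al =>
  if (mdeg al < k)%N then R al else (c al)^-1 *: (phi (monomial x al) -
    \sum_(be <- multinom_seq s (mdeg al))
      R be * partial_pow d be (monomial x al)).
pose R := fix R k := if k is k'.+1 then step k' (R k') else 0.
pose F al := R (mdeg al).+1 al.
(* A coefficient never changes after the stage that settles its degree, so the diagonal [F] agrees
   with [R k] below degree [k]. *)
have RF k al : (mdeg al < k)%N -> R k al = F al.
  elim: k => // k IHk; rewrite ltnS leq_eqVlt => /predU1P[<-//|ltk].
  by rewrite /= /step ltk IHk.
exists F; have linF := series_act_linear F.
pose L : {linear A -> A} := HB.pack_for {linear A -> A} (series_act d F)
  (GRing.isLinear.Build K A A *:%R (series_act d F) linF).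
move=> a; rewrite -[LHS]/(L a); elim: {a}(span_x a) => [|e u w _ Lu _ Lw|al].
- by rewrite !linear0.
- by rewrite !linearP Lu Lw.
have [c0 cE] := cP al.
rewrite /L /= (series_act_monomial F cE) {1}/F /= /step ltnn scalerA divff//.
rewrite scale1r.
rewrite (eq_big_seq (fun be => F be * partial_pow d be (monomial x al))) ?subrK//.
by move=> be; rewrite mem_multinom_seq => /RF ->.
Qed.

End Monomials.

End SeriesAction.

Theorem theorem7p1 (K : fieldType) (charK0 : [pchar K] =i pred0) (n m : nat)
    (An : algType K) (w : 'I_(n + n) -> An) (weylAn : is_weyl_algebra w)
    (A : algType K) (t : An -> {mpoly K[m]} -> A)
    (tensA : is_algebra_tensor_product t)
    (d : 'I_(n + n + m) -> {linear A -> A})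
    (partials_d : are_formal_partials (gens w t) d) :
  exists Phi : series A (n + n + m) -> {linear A -> A},
    [/\ forall F b, Phi F b = series_act d F b,
        is_algebra_hom_to_End d Phi
      & bijective Phi].
Proof.
have [genw relw _] := weylAn.
have genx := gens_generate tensA genw.
have derd i : is_derivation (d i) by have [] := partials_d i.
have dx i j : d i (gens w t j) = (i == j)%:R by have [_] := partials_d i.
have commd i j a : d i (d j a) = d j (d i a).
  (* Both composites send a generator to the derivative of a scalar, which is zero. *)
  apply: (derivations_commute genx) => // k; rewrite !dx -!scaler_nat.
  by rewrite !derivation_scalar.
have nild : forall a, exists N, nilpotent_at d N a.
  apply: (locally_nilpotent derd commd genx) => i j.
  by exists (i == j)%:R; rewrite dx scaler_nat.
have span_x a : in_span (monomial (gens w t)) a.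
  by apply: monomials_span => // i j; exact: gens_comm.
pose Phi F : {linear A -> A} := HB.pack_for {linear A -> A} (series_act d F)
  (GRing.isLinear.Build K A A *:%R (series_act d F) (series_act_linear nild F)).
exists Phi; split=> //.
  split=> [c F G b|b|F G b]; first exact: series_actP.
    exact: series_act1.
  exact: series_act_mul.
(* Surjectivity and choice give a right inverse; injectivity makes it a left inverse too. *)
have [Psi PsiP] := choice (series_act_surj derd commd nild charK0 dx span_x).
have PhiK : cancel Psi Phi by move=> f; apply: eq_linear => a; exact: PsiP.
exists Psi => // F; apply: (series_act_inj derd commd charK0 dx) => a.
exact: PsiP.
Qed.
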